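(* Consider the multi-response linear model $Y_n=X_nB+E_n$ with $Y_n\in\mathbb R^{n\times q}$, $X_n\in\mathbb R^{n\times p}$, $B\in\mathbb R^{p\times q}$, $E_n\in\mathbb R^{n\times q}$, where $X_n$ and $E_n$ are independent and the rows of $E_n$ are i.i.d. $N(0,\Sigma_\varepsilon)$. Then, for any fixed design $X_n$ and any $\lambda>0$, with $\tilde\lambda_n=\lambda/n$ and $S_n=\frac1nX_n^\top X_n$, $$R_{\mathrm{pred}}(\tilde\lambda_n\mid X_n)=\tilde\lambda_n^2\operatorname{tr}\Big(B^\top(S_n+\tilde\lambda_nI_p)^{-1}S_n(S_n+\tilde\lambda_nI_p)^{-1}B\Big)+\frac{\operatorname{tr}(\Sigma_\varepsilon)}{n}\operatorname{tr}\Big(S_n(S_n+\tilde\lambda_nI_p)^{-1}S_n(S_n+\tilde\lambda_nI_p)^{-1}\Big).$$ Moreover, $$\tilde\lambda_n^2\operatorname{tr}\Big(B^\top(S_n+\tilde\lambda_nI_p)^{-1}S_n(S_n+\tilde\lambda_nI_p)^{-1}B\Big)\le\frac{\tilde\lambda_n^2\,\lambda_{\max}(S_n)}{(\lambda_{\min}(S_n)+\tilde\lambda_n)^2}\|B\|_F^2$$ and $$\frac{\operatorname{tr}(\Sigma_\varepsilon)}{n}\operatorname{tr}\Big(S_n(S_n+\tilde\lambda_nI_p)^{-1}S_n(S_n+\tilde\lambda_nI_p)^{-1}\Big)\le\frac{p\operatorname{tr}(\Sigma_\varepsilon)}{n}\,\frac{\lambda_{\max}(S_n)^2}{(\lamb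da_{\min}(S_n)+\tilde\lambda_n)^2}.$$
   Context: $\|\cdot\|_F$ is the Frobenius norm; $\lambda_{\min},\lambda_{\max}$ are the smallest and largest eigenvalues of a symmetric matrix. The ridge estimator is $\hat B_\lambda=(X_n^\top X_n+\lambda I_p)^{-1}X_n^\top Y_n=(S_n+\tilde\lambda_nI_p)^{-1}\frac1nX_n^\top Y_n$. The conditional prediction risk is $$R_{\mathrm{pred}}(\tilde\lambda_n\mid X_n)=\frac1n\mathbb E\big[\|X_n(\hat B_\lambda-B)\|_F^2\,\big|\,X_n\big].$$ The coefficient matrix $B$ and covariance $\Sigma_\varepsilon$ are deterministic. *)

(* Defs.v *)
From HB Require Import structures.
From mathcomp Require Import all_boot all_order all_algebra.
From mathcomp Require Import all_classical all_reals all_analysis.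

Set Implicit Arguments.
Unset Strict Implicit.
Unset Printing Implicit Defensive.

Import Order.TTheory GRing.Theory Num.Theory.
Import numFieldNormedType.Exports.

Local Open Scope classical_set_scope.
Local Open Scope ring_scope.

(* Real matrices carry the sigma-algebra generated by the entry maps, which is
   the Borel sigma-algebra of R^(m * n). *)
Definition mx_cylinders (R : realType) (m n : nat) : set (set 'M[R]_(m, n)) :=
  [set A | exists i j, exists2 B : set R,
     measurable B & A = [set M : 'M[R]_(m, n) | B (M i j)]].

Definition mx_display : measure_display -> measure_display.
Proof. exact. Qed.

Section MatrixMeasurable.
Context (R : realType) (m n : nat).

Let mx_measurable : set (set 'M[R]_(m, n)) := <<s @mx_cylinders R m n >>.

Let mx_measurable0 : mx_measurable set0.
Proof. exact: sigma_algebra0. Qed.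

Let mx_measurableC A : mx_measurable A -> mx_measurable (~` A).
Proof. exact: sigma_algebraC. Qed.

Let mx_measurable_bigcup (F : (set 'M[R]_(m, n))^nat) :
  (forall i, mx_measurable (F i)) -> mx_measurable (\bigcup_i F i).
Proof. exact: sigma_algebra_bigcup. Qed.

HB.instance Definition _ :=
  @isMeasurable.Build (mx_display default_measure_display) 'M[R]_(m, n)
    mx_measurable mx_measurable0 mx_measurableC mx_measurable_bigcup.

End MatrixMeasurable.

Section Probability.
Context d (T : measurableType d) (R : realType) (P : probability T R).

Definition independent_rvs d1 (T1 : measurableType d1) d2
    (T2 : measurableType d2) (X : T -> T1) (Y : T -> T2) : Prop :=
  forall A B, measurable A -> measurable B ->
    P (X @^-1` A `&` Y @^-1` B) = (P (X @^-1` A) * P (Y @^-1` B))%E.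

(* The index type is finite, so the product rule for subfamilies is the case
   where some of the A i are setT. *)
Definition mutually_independent (I : finType) d1 (T1 : measurableType d1)
    (Z : I -> T -> T1) : Prop :=
  forall A : I -> set T1, (forall i, measurable (A i)) ->
    P (\bigcap_(i in [set: I]) (Z i @^-1` A i)) =
    (\prod_(i : I) P (Z i @^-1` A i))%E.

(* Z has law N(mu, v), v being the variance. The degenerate case is separate
   because normal_prob mu 0 is not the point mass at mu. *)
Definition normal_law (Z : T -> R) (mu v : R) : Prop :=
  forall A : set R, measurable A ->
    P (Z @^-1` A) =
    if v == 0 then \d_mu A else normal_prob mu (Num.sqrt v) A.

(* Z has law N(mu, Sigma), with Sigma possibly singular: every linear
   combination of the coordinates is univariate normal. *)
Definition mvnormal_law (q : nat) (Z : T -> 'rV[R]_q) (mu : 'rV[R]_q)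
    (Sigma : 'M[R]_q) : Prop :=
  forall a : 'cV[R]_q,
    normal_law (fun w => (Z w *m a) 0 0) ((mu *m a) 0 0)
               ((a^T *m Sigma *m a) 0 0).

(* g is a version of the conditional expectation E[Z | X]. *)
Definition cond_expectation d1 (T1 : measurableType d1) (X : T -> T1)
    (Z g : T -> R) : Prop :=
  [/\ P.-integrable setT (EFin \o Z),
      P.-integrable setT (EFin \o g),
      (forall B : set R, measurable B ->
         preimage_set_system setT X measurable (g @^-1` B)) &
      (forall A, preimage_set_system setT X measurable A ->
         \int[P]_(w in A) (g w)%:E = \int[P]_(w in A) (Z w)%:E)%E].

End Probability.

Section Matrices.
Context (R : realType).

Definition frobenius_norm m n (A : 'M[R]_(m, n)) : R :=
  Num.sqrt (\sum_i \sum_j A i j ^+ 2).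

Definition psd_mx n (A : 'M[R]_n) : Prop :=
  A^T = A /\ forall a : 'cV[R]_n, 0 <= (a^T *m A *m a) 0 0.

(* For a symmetric matrix of positive size the set of eigenvalues is finite and
   nonempty, so that the infimum and the supremum are attained. *)
Definition lambda_min n (A : 'M[R]_n) : R := inf [set a | eigenvalue A a].
Definition lambda_max n (A : 'M[R]_n) : R := sup [set a | eigenvalue A a].

End Matrices.

Section Ridge.
Context (R : realType) (n p q : nat).
Implicit Types (x : 'M[R]_(n, p)) (y : 'M[R]_(n, q)) (B : 'M[R]_(p, q)).
Implicit Types (lam lamt : R) (S : 'M[R]_p).

Definition gram x : 'M[R]_p := n%:R^-1 *: (x^T *m x).

Definition ridge lam x y : 'M[R]_(p, q) :=
  invmx (x^T *m x + lam%:M) *m x^T *m y.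

Definition sq_pred_error lam x y B : R :=
  frobenius_norm (x *m (ridge lam x y - B)) ^+ 2.

Definition ridge_bias lamt S B : R :=
  lamt ^+ 2 *
  \tr (B^T *m invmx (S + lamt%:M) *m S *m invmx (S + lamt%:M) *m B).

Definition ridge_variance lamt S (Sigma : 'M[R]_q) : R :=
  \tr Sigma / n%:R *
  \tr (S *m invmx (S + lamt%:M) *m S *m invmx (S + lamt%:M)).

Context d (T : measurableType d) (P : probability T R).

(* r is a version of the random variable R_pred( . | X). *)
Definition cond_pred_risk lam (X : T -> 'M[R]_(n, p)) (Y : T -> 'M[R]_(n, q))
    B (r : T -> R) : Prop :=
  exists2 g : T -> R,
    cond_expectation P X (fun w => sq_pred_error lam (X w) (Y w) B) g
    & forall w, r w = n%:R^-1 * g w.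

(* R_pred( . | X = x): the design is frozen at x and only the noise E is
   averaged out. *)
Definition fixed_design_pred_risk lam x (E : T -> 'M[R]_(n, q)) B : \bar R :=
  ((n%:R^-1)%:E * 'E_P[fun w => sq_pred_error lam x (x *m B + E w) B])%E.

End Ridge.

(* Main.v *)
Require Import Defs.
From HB Require Import structures.
From mathcomp Require Import all_boot all_order all_algebra.
From mathcomp Require Import all_classical all_reals all_analysis.
From mathcomp Require Import measurable_realfun ring lra.

(** Write [M = (X^T X + lam I)^-1], [G = X M] and [H = X M X^T] (the hat
    matrix).  Since [M X^T X = I - lam M], substituting [Y = X B + E] gives
    [X (Bhat - B) = H E - lam G B], hence
    [|X (Bhat - B)|^2 = |lam G B|^2 + (linear form in E) + tr (E^T H^T H E)].
    The entries of [E] are centred, and [E_ij], [E_kj] are uncorrelated for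
    [i <> k] with variance [Sigma_jj] for [i = k], so averaging over the noise
    kills the linear form and leaves
    [|lam G B|^2 + tr Sigma * tr (H^T H)].  After dividing by [n] and rewriting
    [M] through the Gram matrix this is bias plus variance
    ([sq_pred_errorE], [expected_errorE]).

    For the risk conditional on a random design, each coefficient of the
    expansion is a function of [X] only, and remains so when multiplied by the
    indicator of an event of the sigma-algebra of [X].  Independence of [X] and
    [E] therefore lets the expectation of every product factor
    ([weighted_error_mean]).  Integrability is automatic because the
    coefficients are bounded uniformly in the design: from
    [H^2 = H - lam G G^T] every row of [H] and [G] satisfies
    [sum_k H_ik^2 + lam sum_j G_ij^2 = H_ii <= 1] ([hat_row_le1]).  A fixed
    design is the case of a constant, hence independent, [X].

    The only fact about the normal law beyond its symmetry is that [N(0, v)]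
    has second moment [v].  It reduces to the integral of
    [x^2 exp (- x^2)], whose primitive is half the difference of the primitive
    of [exp (- x^2)] and [x exp (- x^2)] ([integral0y_sqr_gauss]).

    The two inequalities only need the variational bounds
    [lambda_min |u|^2 <= u^T S u <= lambda_max |u|^2].  They are obtained
    without diagonalizing [S]: if [a] is the supremum of the Rayleigh quotients
    then [a I - S] is positive semidefinite, and it cannot be invertible, since
    an invertible positive semidefinite matrix is bounded below by a positive
    multiple of the identity, which would lower the supremum.  So [a] is an
    eigenvalue ([lambda_max_spec]). *)

Set Implicit Arguments.
Unset Strict Implicit.
Unset Printing Implicit Defensive.

Import Order.TTheory GRing.Theory Num.Theory.
Import numFieldNormedType.Exports.

Local Open Scope classical_set_scope.
Local Open Scope ring_scope.

(** * Quadratic forms and the Frobenius norm *)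

Section QuadraticForms.
Context {R : realType}.

Definition bform m (A : 'M[R]_m) (u v : 'cV[R]_m) : R := (u^T *m A *m v) 0 0.
Definition sqnorm m (u : 'cV[R]_m) : R := bform 1%:M u u.
Definition sqfrob m k (A : 'M[R]_(m, k)) : R := \sum_i \sum_j A i j ^+ 2.

Lemma bformDl m (A : 'M[R]_m) u v w :
  bform A (u + v) w = bform A u w + bform A v w.
Proof. by rewrite /bform linearD/= !mulmxDl mxE. Qed.

Lemma bformDr m (A : 'M[R]_m) u v w :
  bform A u (v + w) = bform A u v + bform A u w.
Proof. by rewrite /bform mulmxDr mxE. Qed.

Lemma bformZl m (A : 'M[R]_m) a u v : bform A (a *: u) v = a * bform A u v.
Proof. by rewrite /bform linearZ/= -!scalemxAl mxE. Qed.

Lemma bformZr m (A : 'M[R]_m) a u v : bform A u (a *: v) = a * bform A u v.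
Proof. by rewrite /bform -!scalemxAr mxE. Qed.

Lemma bform_addmx m (A B : 'M[R]_m) u v :
  bform (A + B) u v = bform A u v + bform B u v.
Proof. by rewrite /bform mulmxDr mulmxDl mxE. Qed.

Lemma bform_oppmx m (A : 'M[R]_m) u v : bform (- A) u v = - bform A u v.
Proof. by rewrite /bform mulmxN mulNmx mxE. Qed.

Lemma bform_scalar m a (u v : 'cV[R]_m) : bform a%:M u v = a * bform 1%:M u v.
Proof.
by rewrite /bform mul_mx_scalar mulmx1 -scalemxAl mxE.
Qed.

Lemma bform_sym m (A : 'M[R]_m) u v : A^T = A -> bform A u v = bform A v u.
Proof.
move=> As; rewrite /bform -[in LHS](trmxK (u^T *m A *m v)) [LHS]mxE.
by rewrite !trmx_mul trmxK As mulmxA.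
Qed.

Lemma bform1E m (u v : 'cV[R]_m) : bform 1%:M u v = (u^T *m v) 0 0.
Proof. by rewrite /bform mulmx1. Qed.

Lemma bform_mulmxr m (A : 'M[R]_m) u v : bform 1%:M u (A *m v) = bform A u v.
Proof. by rewrite bform1E /bform mulmxA. Qed.

Lemma bform_mulmx_self m (A : 'M[R]_m) u : A^T = A ->
  bform A u (A *m u) = sqnorm (A *m u).
Proof. by move=> As; rewrite (bform_sym _ _ As) -bform_mulmxr. Qed.

Lemma sqnormE m (u : 'cV[R]_m) : sqnorm u = \sum_i u i 0 ^+ 2.
Proof.
by rewrite /sqnorm bform1E mxE; apply: eq_bigr => i _; rewrite mxE expr2.
Qed.

Lemma sqnorm_ge0 m (u : 'cV[R]_m) : 0 <= sqnorm u.
Proof. by rewrite sqnormE sumr_ge0// => i _; rewrite sqr_ge0. Qed.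

Lemma sqnorm_eq0 m (u : 'cV[R]_m) : (sqnorm u == 0) = (u == 0).
Proof.
apply/eqP/eqP => [|->]; last first.
  by rewrite sqnormE big1// => i _; rewrite mxE expr0n.
rewrite sqnormE => /psumr_eq0P u0; apply/colP => i; rewrite mxE.
by apply/eqP; rewrite -sqrf_eq0 u0// => j _; rewrite sqr_ge0.
Qed.

Lemma sqnorm_gt0 m (u : 'cV[R]_m) : (0 < sqnorm u) = (u != 0).
Proof. by rewrite lt_neqAle sqnorm_ge0 andbT eq_sym sqnorm_eq0. Qed.

Lemma psd_scalar m (a : R) : 0 <= a -> psd_mx (a%:M : 'M[R]_m).
Proof.
move=> a0; split=> [|u]; first by rewrite tr_scalar_mx.
by rewrite -/(bform _ _ _) bform_scalar mulr_ge0// sqnorm_ge0.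
Qed.

(** The quadratic form is nonnegative at [b *: u - a *: v] with [b = v^T A v]
    and [a = u^T A v]; when [v^T A v = 0] this vector says nothing, and adding a large multiple
    of [v] to [u] forces [u^T A v = 0]. *)
Lemma psd_cauchy_schwarz m (A : 'M[R]_m) u v : psd_mx A ->
  bform A u v ^+ 2 <= bform A u u * bform A v v.
Proof.
move=> [As A0].
have qE a b : bform A (a *: u + b *: v) (a *: u + b *: v) =
    a ^+ 2 * bform A u u + a * b * bform A u v *+ 2 + b ^+ 2 * bform A v v.
  rewrite !bformDl !bformDr !bformZl !bformZr (bform_sym v u As).
  by ring.
have q0 a b := A0 (a *: u + b *: v).
have vv0 : 0 <= bform A v v := A0 v.
have := vv0; rewrite le_eqVlt => /predU1P[vv|vv].
- have [uv|uv] := eqVneq (bform A u v) 0.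
    by rewrite uv expr0n mulr_ge0// A0.
  (* This multiple of [v] would make the value of the form equal to [-1]. *)
  have := q0 1 (- (bform A u u + 1) / (bform A u v *+ 2)).
  rewrite -/(bform _ _ _) qE -vv mulr0 addr0.
  have -> : 1 ^+ 2 * bform A u u +
      1 * (- (bform A u u + 1) / (bform A u v *+ 2)) * bform A u v *+ 2 = -1.
    by field.
  by rewrite oppr_ge0 ler10.
- rewrite -subr_ge0 -(pmulr_rge0 _ vv).
  have := q0 (bform A v v) (- bform A u v); rewrite -/(bform _ _ _) qE.
  by move/le_trans; apply; rewrite le_eqVlt; apply/orP; left; apply/eqP; ring.
Qed.

Lemma sqfrob_ge0 m k (A : 'M[R]_(m, k)) : 0 <= sqfrob A.
Proof. by apply: sumr_ge0 => i _; apply: sumr_ge0 => j _; exact: sqr_ge0. Qed.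

(** Row by row, this is the Cauchy-Schwarz inequality. *)
Lemma sqnorm_mulmx_le m k (A : 'M[R]_(m, k)) u :
  sqnorm (A *m u) <= sqfrob A * sqnorm u.
Proof.
rewrite sqnormE /sqfrob mulr_suml; apply: ler_sum => i _.
have -> : (A *m u) i 0 = bform 1%:M (row i A)^T u.
  by rewrite bform1E trmxK -row_mul [RHS]mxE.
apply: le_trans (psd_cauchy_schwarz _ _ (psd_scalar _ ler01)) _.
rewrite -/(sqnorm _) -/(sqnorm u) sqnormE ler_wpM2r ?sqnorm_ge0//.
by rewrite le_eqVlt; apply/orP; left; apply/eqP/eq_bigr => j _; rewrite !mxE.
Qed.

(** Expand [0 <= |u - A u|^2].  The constant is crude; it only serves to make
    Rayleigh quotients bounded. *)
Lemma bform_le_sqnorm m (A : 'M[R]_m) u :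
  bform A u u <= (1 + sqfrob A) / 2 * sqnorm u.
Proof.
have := sqnorm_ge0 (u - A *m u).
have s1 : (1%:M : 'M[R]_m)^T = 1%:M by rewrite tr_scalar_mx.
rewrite /sqnorm -scaleN1r !bformDl !bformDr !bformZl !bformZr.
rewrite (bform_sym (A *m u) u s1) bform_mulmxr.
have := sqnorm_mulmx_le A u; rewrite /sqnorm; lra.
Qed.

End QuadraticForms.

(** * Extreme eigenvalues of a symmetric matrix *)

Section ExtremeEigenvalues.
Context {R : realType}.

(** An invertible positive semidefinite matrix is positive definite, with a
    uniform constant.  Cauchy-Schwarz for the form [A] between [u] and [A u]
    bounds [|A u|^2] by a multiple of [u^T A u], and [u] is recovered from
    [A u] by the bounded map [invmx A]. *)
Lemma sqnorm_le_bform_unit m (A : 'M[R]_m) : psd_mx A -> A \in unitmx ->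
  exists2 K, 0 < K & forall u, sqnorm u <= K * bform A u u.
Proof.
move=> Apsd Au; pose C := (1 + sqfrob A) / 2.
have C0 : 0 < C by have := sqfrob_ge0 A; rewrite /C; lra.
have ge0q u : 0 <= bform A u u by case: Apsd => _; exact.
exists (sqfrob (invmx A) * C + 1).
  by have := sqfrob_ge0 (invmx A); have := C0; nra.
move=> u.
have NAu : sqnorm (A *m u) <= C * bform A u u.
  have [->|N0] := eqVneq (sqnorm (A *m u)) 0.
    by rewrite mulr_ge0 ?(ltW C0).
  have {}N0 : 0 < sqnorm (A *m u) by rewrite lt_neqAle eq_sym N0 sqnorm_ge0.
  rewrite -(ler_pM2r N0).
  have -> : sqnorm (A *m u) * sqnorm (A *m u) = bform A u (A *m u) ^+ 2.
    by rewrite expr2 bform_mulmx_self//; case: Apsd.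
  apply: le_trans (psd_cauchy_schwarz _ _ Apsd) _.
  by rewrite mulrAC mulrC ler_wpM2r ?ge0q ?bform_le_sqnorm.
rewrite -{1}(mulKmx Au u); apply: le_trans (sqnorm_mulmx_le _ _) _.
apply: le_trans (ler_wpM2l (sqfrob_ge0 _) NAu) _.
by rewrite mulrDl mul1r mulrA lerDl ge0q.
Qed.

Lemma eigenvalue_bform m (A : 'M[R]_m) a : A^T = A -> eigenvalue A a ->
  exists2 u : 'cV[R]_m, u != 0 & bform A u u = a * sqnorm u.
Proof.
move=> As /eigenvalueP[v vA v0]; exists v^T.
  by apply: contra_neq v0 => v0; rewrite -(trmxK v) v0 trmx0.
by rewrite /sqnorm bform1E /bform trmxK vA -scalemxAl mxE.
Qed.

Lemma singular_eigenvalue m (A : 'M[R]_m) a :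
  (a%:M - A) \notin unitmx -> eigenvalue A a.
Proof.
rewrite unitmxE unitfE negbK => /det0P[v v0 vA].
apply/eigenvalueP; exists v => //.
by move/eqP: vA; rewrite mulmxBr subr_eq0 mul_mx_scalar => /eqP.
Qed.

(** The supremum [a] of the Rayleigh quotients is an eigenvalue: otherwise
    [a%:M - A] would be invertible and positive semidefinite, hence bounded
    below by [K^-1], and no quotient could exceed [a - K^-1].  Eigenvalues are
    themselves Rayleigh quotients, so [a] is the largest one. *)
Lemma lambda_max_spec m (A : 'M[R]_m) : (0 < m)%N -> A^T = A ->
  eigenvalue A (lambda_max A) /\
  forall u, bform A u u <= lambda_max A * sqnorm u.
Proof.
move=> m0 As.
pose Q := [set bform A u u / sqnorm u | u in [set u : 'cV[R]_m | u != 0]].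
have Qub : ubound Q ((1 + sqfrob A) / 2).
  move=> _ [u u0 <-]; rewrite ler_pdivrMr ?sqnorm_gt0//.
  exact: bform_le_sqnorm.
have Qsup : has_sup Q.
  split; last by exists ((1 + sqfrob A) / 2).
  pose u : 'cV[R]_m := const_mx 1.
  exists (bform A u u / sqnorm u), u => //=.
  apply/eqP => /matrixP/(_ (Ordinal m0) 0)/eqP.
  by rewrite !mxE oner_eq0.
pose a := sup Q.
have aP u : bform A u u <= a * sqnorm u.
  have [->|u0] := eqVneq u 0.
    by rewrite /sqnorm /bform trmx0 !mul0mx mxE mulr0.
  rewrite -ler_pdivrMr ?sqnorm_gt0//.
  by apply: ub_le_sup; [case: Qsup|exists u].
have Ea : eigenvalue A a.
  apply: singular_eigenvalue; apply/negP => Mu.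
  have Mpsd : psd_mx (a%:M - A).
    split=> [|u]; first by rewrite linearB/= tr_scalar_mx As.
    by rewrite -/(bform _ _ _) bform_addmx bform_oppmx bform_scalar subr_ge0 aP.
  have [K K0 KP] := sqnorm_le_bform_unit Mpsd Mu.
  have : sup Q <= a - K^-1.
    apply: sup_le_ub => [|_ [u u0 <-]]; first by case: Qsup.
    rewrite ler_pdivrMr ?sqnorm_gt0// mulrBl lerBrDr -lerBrDl.
    rewrite ler_pdivrMl//; have := KP u.
    by rewrite bform_addmx bform_oppmx bform_scalar.
  by rewrite -/a leNgt ltrBlDr ltrDl invr_gt0 K0.
suff -> : lambda_max A = a by [].
apply/le_anti/andP; split.
- apply: sup_le_ub; first by exists a.
  move=> b /= /(eigenvalue_bform As)[u u0 bE].
  by rewrite -(@ler_pM2r _ (sqnorm u)) ?sqnorm_gt0// -bE.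
- apply: ub_le_sup => //; exists a => b /= /(eigenvalue_bform As)[u u0 bE].
  by rewrite -(@ler_pM2r _ (sqnorm u)) ?sqnorm_gt0// -bE.
Qed.

Lemma eigenvalueN m (A : 'M[R]_m) a : eigenvalue (- A) a = eigenvalue A (- a).
Proof.
apply/eigenvalueP/eigenvalueP => -[v vA v0]; exists v => //.
  by rewrite scaleNr -vA mulmxN opprK.
by rewrite mulmxN vA scaleNr opprK.
Qed.

Lemma lambda_minE m (A : 'M[R]_m) : lambda_min A = - lambda_max (- A).
Proof.
rewrite /lambda_min /inf; congr (- sup _).
apply/seteqP; split => [_ [a Ea <-]|a].
  by rewrite /= eigenvalueN opprK.
by rewrite /= eigenvalueN => Ea; exists (- a); rewrite ?opprK.
Qed.

Lemma lambda_min_spec m (A : 'M[R]_m) : (0 < m)%N -> A^T = A ->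
  eigenvalue A (lambda_min A) /\
  forall u, lambda_min A * sqnorm u <= bform A u u.
Proof.
move=> m0 As; have NAs : (- A)^T = - A by rewrite linearN/= As.
have [EN NP] := lambda_max_spec m0 NAs.
rewrite lambda_minE; split=> [|u]; first by rewrite -eigenvalueN.
by rewrite mulNr lerNl -bform_oppmx.
Qed.

Lemma psd_eigenvalue_ge0 m (A : 'M[R]_m) a :
  psd_mx A -> eigenvalue A a -> 0 <= a.
Proof.
move=> [As A0] /(eigenvalue_bform As)[u u0 bE].
by rewrite -(@pmulr_lge0 _ (sqnorm u)) ?sqnorm_gt0// -bE A0.
Qed.

End ExtremeEigenvalues.

Section Resolvent.
Context {R : realType} (m : nat) (S : 'M[R]_m) (t : R).
Hypotheses (m_gt0 : (0 < m)%N) (S_psd : psd_mx S) (t_gt0 : 0 < t).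
Let T := S + t%:M.

Let lmin_ge0 : 0 <= lambda_min S.
Proof.
apply: psd_eigenvalue_ge0 (S_psd) _.
by have [] := lambda_min_spec m_gt0 (proj1 S_psd).
Qed.

Let lmax_ge0 : 0 <= lambda_max S.
Proof.
apply: psd_eigenvalue_ge0 (S_psd) _.
by have [] := lambda_max_spec m_gt0 (proj1 S_psd).
Qed.

Lemma trmx_shift : T^T = T.
Proof. by rewrite /T linearD/= tr_scalar_mx (proj1 S_psd). Qed.

Lemma shift_unitmx : T \in unitmx.
Proof.
rewrite unitmxE unitfE; apply/det0P => -[v v0 vT].
have : bform T v^T v^T = 0 by rewrite /bform trmxK vT mul0mx mxE.
rewrite /T bform_addmx bform_scalar => /eqP.
rewrite paddr_eq0 ?(proj2 S_psd)//; last by rewrite mulr_ge0 ?sqnorm_ge0 ?ltW.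
rewrite mulf_eq0 (gt_eqF t_gt0)/= -/(sqnorm _) sqnorm_eq0 => /andP[_ /eqP vt].
by move: v0; rewrite -(trmxK v) vt trmx0 eqxx.
Qed.

(** With [u = (S + t)^-1 v], the Rayleigh bound and Cauchy-Schwarz give
    [(lambda_min + t) |u|^2 <= u^T (S + t) u = u^T v <= |u| |v|]. *)
Lemma sqnorm_resolvent_le v :
  sqnorm (invmx T *m v) <= sqnorm v / (lambda_min S + t) ^+ 2.
Proof.
set u := invmx T *m v; have vE : v = T *m u by rewrite mulKVmx ?shift_unitmx.
have d0 : 0 < lambda_min S + t by rewrite ltr_wpDl.
rewrite ler_pdivlMr ?exprn_gt0//.
have [u0|u0] := eqVneq u 0.
  by rewrite u0 (eqP (_ : sqnorm 0 == 0)) ?sqnorm_eq0// mul0r sqnorm_ge0.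
rewrite -(ler_pM2l (_ : 0 < sqnorm u)) ?sqnorm_gt0//.
have CS := psd_cauchy_schwarz u v (psd_scalar m ler01).
apply: le_trans CS; rewrite mulrA -expr2 -exprMn.
rewrite vE bform_mulmxr ler_pXn2r ?nnegrE//.
- rewrite /T bform_addmx bform_scalar -/(sqnorm _) mulrC mulrDl lerD2r.
  by have [_] := lambda_min_spec m_gt0 (proj1 S_psd); exact.
- by rewrite mulr_ge0 ?sqnorm_ge0 ?ltW.
- rewrite /T bform_addmx bform_scalar addr_ge0 ?(proj2 S_psd)//.
  by rewrite mulr_ge0 ?sqnorm_ge0 ?ltW.
Qed.

(** Cauchy-Schwarz for the form [S] between [u] and [S u] replaces the square
    root of [S]. *)
Lemma sqnorm_psd_mul_le u : sqnorm (S *m u) <= lambda_max S ^+ 2 * sqnorm u.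
Proof.
have [->|N0] := eqVneq (sqnorm (S *m u)) 0.
  by rewrite mulr_ge0 ?sqr_ge0 ?sqnorm_ge0.
have {}N0 : 0 < sqnorm (S *m u) by rewrite lt_neqAle eq_sym N0 sqnorm_ge0.
have [_ maxP] := lambda_max_spec m_gt0 (proj1 S_psd).
rewrite -(ler_pM2r N0).
have -> : sqnorm (S *m u) * sqnorm (S *m u) = bform S u (S *m u) ^+ 2.
  by rewrite expr2 bform_mulmx_self//; case: S_psd.
apply: le_trans (psd_cauchy_schwarz _ _ S_psd) _.
have -> : lambda_max S ^+ 2 * sqnorm u * sqnorm (S *m u) =
  (lambda_max S * sqnorm u) * (lambda_max S * sqnorm (S *m u)) by ring.
by rewrite ler_pM ?maxP//; exact: (proj2 S_psd).
Qed.

Lemma trmx_resolvent : (invmx T)^T = invmx T.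
Proof. by rewrite trmx_inv trmx_shift. Qed.

Lemma bform_bias_le v :
  bform (invmx T *m S *m invmx T) v v <=
  lambda_max S / (lambda_min S + t) ^+ 2 * sqnorm v.
Proof.
have -> : bform (invmx T *m S *m invmx T) v v =
    bform S (invmx T *m v) (invmx T *m v).
  by rewrite /bform trmx_mul trmx_resolvent !mulmxA.
have [_ maxP] := lambda_max_spec m_gt0 (proj1 S_psd).
apply: le_trans (maxP _) _.
by rewrite -mulrA ler_wpM2l// mulrC sqnorm_resolvent_le.
Qed.

Lemma mxtrace_bform k (A : 'M[R]_m) (B : 'M[R]_(m, k)) :
  \tr (B^T *m A *m B) = \sum_j bform A (col j B) (col j B).
Proof.
apply: eq_bigr => j _; rewrite /bform colE trmx_mul trmx_delta.
by rewrite !mulmxA -colE -!mulmxA -rowE !mxE.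
Qed.

End Resolvent.

(** * Ridge bounds and the ridge error *)

Section RidgeBounds.
Context {R : realType}.

Lemma frobenius_norm_sqr m k (A : 'M[R]_(m, k)) :
  frobenius_norm A ^+ 2 = sqfrob A.
Proof. by rewrite sqr_sqrtr// sqfrob_ge0. Qed.

Lemma sqfrob_tr m k (A : 'M[R]_(m, k)) : sqfrob A = \tr (A^T *m A).
Proof.
rewrite /sqfrob exchange_big; apply: eq_bigr => j _; rewrite mxE.
by apply: eq_bigr => i _; rewrite mxE expr2.
Qed.

Lemma sqfrob_col m k (A : 'M[R]_(m, k)) : sqfrob A = \sum_j sqnorm (col j A).
Proof.
rewrite /sqfrob exchange_big; apply: eq_bigr => j _.
by rewrite sqnormE; apply: eq_bigr => i _; rewrite mxE.
Qed.

(** The trace is the sum, over the columns of [B], of the values of the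
    quadratic form [(S + t)^-1 S (S + t)^-1]. *)
Lemma ridge_bias_le m k (S : 'M[R]_m) (t : R) (B : 'M[R]_(m, k)) :
  (0 < m)%N -> psd_mx S -> 0 < t ->
  ridge_bias t S B <=
  t ^+ 2 * lambda_max S / (lambda_min S + t) ^+ 2 * frobenius_norm B ^+ 2.
Proof.
move=> m0 Spsd t0.
rewrite /ridge_bias -!(mulrA (t ^+ 2)) ler_wpM2l ?sqr_ge0//.
rewrite -2!(mulmxA B^T) mxtrace_bform frobenius_norm_sqr sqfrob_col mulr_sumr.
by apply: ler_sum => j _; rewrite bform_bias_le.
Qed.

Lemma psd_mxtrace_ge0 m (A : 'M[R]_m) : psd_mx A -> 0 <= \tr A.
Proof.
move=> [_ A0]; have -> : A = 1%:M^T *m A *m 1%:M by rewrite trmx1 mul1mx mulmx1.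
by rewrite mxtrace_bform sumr_ge0// => j _; exact: A0.
Qed.

(** As [S] commutes with its resolvent, the trace is the sum over the canonical
    basis of [|S (S + t)^-1 e_j|^2]. *)
Lemma ridge_variance_le m k n (S : 'M[R]_m) (t : R) (Sigma : 'M[R]_k) :
  (0 < m)%N -> psd_mx S -> 0 < t -> psd_mx Sigma ->
  ridge_variance n t S Sigma <=
  m%:R * \tr Sigma / n%:R
    * (lambda_max S ^+ 2 / (lambda_min S + t) ^+ 2).
Proof.
move=> m0 Spsd t0 Sigma_psd; rewrite /ridge_variance.
have Tu := shift_unitmx Spsd t0.
set V := invmx (S + t%:M).
have comm : S *m V = V *m S.
  have comT : S *m (S + t%:M) = (S + t%:M) *m S.
    by rewrite mulmxDr mulmxDl mul_mx_scalar mul_scalar_mx.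
  rewrite -[LHS](mulKmx Tu) (mulmxA (S + _)) -comT.
  by rewrite -(mulmxA S) mulmxV ?mulmx1.
have -> : m%:R * \tr Sigma / n%:R *
    (lambda_max S ^+ 2 / (lambda_min S + t) ^+ 2)
  = \tr Sigma / n%:R
    * (m%:R * (lambda_max S ^+ 2 / (lambda_min S + t) ^+ 2)) by ring.
rewrite ler_wpM2l ?divr_ge0 ?psd_mxtrace_ge0//.
rewrite comm.
have -> : V *m S *m S *m V = 1%:M^T *m (V *m S *m S *m V) *m 1%:M.
  by rewrite trmx1 mul1mx mulmx1.
rewrite mxtrace_bform mulr_natl -[X in _ *+ X]card_ord -sumr_const.
apply: ler_sum => j _; set e := col j 1%:M.
have -> : bform (V *m S *m S *m V) e e = sqnorm (S *m (V *m e)).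
  rewrite /sqnorm bform1E /bform !trmx_mul (trmx_resolvent _ Spsd).
  by rewrite (proj1 Spsd) !mulmxA.
apply: le_trans (sqnorm_psd_mul_le m0 Spsd _) _.
rewrite ler_wpM2l ?sqr_ge0//.
apply: le_trans (sqnorm_resolvent_le m0 Spsd t0 _) _.
suff -> : sqnorm e = 1 by rewrite mul1r.
rewrite sqnormE (bigD1 j)//= big1 ?addr0.
  by rewrite !mxE eqxx expr1n.
by move=> i ij; rewrite !mxE (negbTE ij) expr0n.
Qed.

Lemma psd_trmx_mul n p (x : 'M[R]_(n, p)) : psd_mx (x^T *m x).
Proof.
split=> [|u]; first by rewrite trmx_mul trmxK.
have := sqnorm_ge0 (x *m u).
by rewrite /sqnorm bform1E trmx_mul !mulmxA.
Qed.

Lemma psd_gram n p (x : 'M[R]_(n, p)) : psd_mx (gram x).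
Proof.
have [xs x0] := psd_trmx_mul x; split=> [|u].
  by rewrite /gram linearZ/= xs.
by rewrite /gram -scalemxAr -scalemxAl mxE mulr_ge0 ?invr_ge0.
Qed.

End RidgeBounds.

Section RidgeAlgebra.
Context {R : realType} (n p q : nat) (lam : R).
Hypothesis lam_gt0 : 0 < lam.
Implicit Types (x : 'M[R]_(n, p)) (B : 'M[R]_(p, q)) (e : 'M[R]_(n, q)).

Definition ridge_inv x := invmx (x^T *m x + lam%:M).
(** [lam *: (shrink x *m B)] is the part of the signal [x *m B] that the
    penalty removes. *)
Definition shrink x := x *m ridge_inv x.
Definition hat x := shrink x *m x^T.

Let reg_unit x : x^T *m x + lam%:M \in unitmx.
Proof. exact: shift_unitmx (psd_trmx_mul x) lam_gt0. Qed.

Let gram_ridge_inv x : x^T *m x *m ridge_inv x = 1%:M - lam *: ridge_inv x.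
Proof.
by rewrite -(mulmxV (reg_unit x)) -/(ridge_inv x) mulmxDl mul_scalar_mx addrK.
Qed.

Let ridge_inv_gram x : ridge_inv x *m (x^T *m x) = 1%:M - lam *: ridge_inv x.
Proof.
by rewrite -(mulVmx (reg_unit x)) -/(ridge_inv x) mulmxDr mul_mx_scalar addrK.
Qed.

Lemma tr_hat x : (hat x)^T = hat x.
Proof.
rewrite /hat /shrink !trmx_mul trmxK /ridge_inv.
by rewrite (trmx_resolvent _ (psd_trmx_mul x)) mulmxA.
Qed.

(** The failure of the hat matrix to be a projection; it comes from
    [x^T x M = 1 - lam M] for [M = ridge_inv x]. *)
Lemma hat_hat x : hat x *m hat x = hat x - lam *: (shrink x *m (shrink x)^T).
Proof.
have -> : (shrink x)^T = ridge_inv x *m x^T.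
  by rewrite /shrink trmx_mul (trmx_resolvent _ (psd_trmx_mul x)).
have -> : hat x *m hat x = x *m ridge_inv x *m (x^T *m x *m ridge_inv x) *m x^T.
  by rewrite /hat /shrink !mulmxA.
rewrite gram_ridge_inv mulmxBr mulmxBl mulmx1; congr (_ - _).
by rewrite -scalemxAr -scalemxAl /shrink !mulmxA.
Qed.

Lemma hat_diag x i :
  hat x i i = \sum_k hat x i k ^+ 2 + lam * \sum_j shrink x i j ^+ 2.
Proof.
have entry (A C D : 'M[R]_n) : A = C - lam *: D -> C i i = A i i + lam * D i i.
  by move=> ->; rewrite !mxE subrK.
have sqrE k (A : 'M[R]_(n, k)) : (A *m A^T) i i = \sum_j A i j ^+ 2.
  by rewrite mxE; apply: eq_bigr => j _; rewrite mxE expr2.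
by rewrite (entry _ _ _ (hat_hat x)) sqrE -{2}tr_hat sqrE.
Qed.

Let sum_sqr_ge0 k (f : 'I_k -> R) : 0 <= \sum_i f i ^+ 2.
Proof. by apply: sumr_ge0 => i _; exact: sqr_ge0. Qed.

Let sqr_le_sum k (f : 'I_k -> R) i : f i ^+ 2 <= \sum_i f i ^+ 2.
Proof. by rewrite (bigD1 i)//= lerDl sumr_ge0// => j _; exact: sqr_ge0. Qed.

(** The left-hand side is [h = hat x i i] by [hat_diag], and it dominates
    [h ^+ 2], so [h <= 1]. *)
Lemma hat_row_le1 x i :
  \sum_k hat x i k ^+ 2 + lam * \sum_j shrink x i j ^+ 2 <= 1.
Proof.
have := hat_diag x i; have := sqr_le_sum (hat x i) i.
have := mulr_ge0 (ltW lam_gt0) (sum_sqr_ge0 (shrink x i)).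
by nra.
Qed.

Lemma hat_entry_le1 x i k : `|hat x i k| <= 1.
Proof.
rewrite -(@ler_pXn2r _ 2)// ?nnegrE// expr1n -normrX ger0_norm ?sqr_ge0//.
have := hat_row_le1 x i; have := sqr_le_sum (hat x i) k.
have := mulr_ge0 (ltW lam_gt0) (sum_sqr_ge0 (shrink x i)).
by lra.
Qed.

Lemma shrink_entry_le1 x i j : lam * shrink x i j ^+ 2 <= 1.
Proof.
have := hat_row_le1 x i; have := sum_sqr_ge0 (hat x i).
have := ler_wpM2l (ltW lam_gt0) (sqr_le_sum (shrink x i) j).
by lra.
Qed.

(** The noise enters through the hat matrix, the signal only through the
    shrinkage. *)
Lemma ridge_error x B e :
  x *m (ridge lam x (x *m B + e) - B) = hat x *m e - lam *: (shrink x *m B).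
Proof.
rewrite /ridge -/(ridge_inv x) mulmxBr mulmxDr mulmxDr !mulmxA -/(shrink x).
rewrite -/(hat x) addrAC addrC; congr (_ + _).
have -> : hat x *m x = x - lam *: shrink x.
  rewrite /hat -mulmxA /shrink -mulmxA ridge_inv_gram mulmxBr mulmx1.
  by rewrite -scalemxAr.
by rewrite mulmxBl addrAC subrr add0r -scalemxAl.
Qed.

(** [err_const], [err_lin] and [err_quad] are the coefficients of the squared
    prediction error as a polynomial of degree two in the noise. *)
Definition err_const x B := sqfrob (lam *: (shrink x *m B)).
Definition err_lin x B := (- 2 * lam) *: ((hat x)^T *m (shrink x *m B)).
Definition err_quad x := (hat x)^T *m hat x.

Lemma sq_pred_errorE x B e : sq_pred_error lam x (x *m B + e) B =
  err_const x B + \sum_i \sum_j err_lin x B i j * e i j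
  + \sum_i \sum_k \sum_j err_quad x i k * (e i j * e k j).
Proof.
rewrite /sq_pred_error frobenius_norm_sqr ridge_error.
have trE k (C : 'M[R]_(n, k)) (D : 'M[R]_(n, k)) :
    \sum_i \sum_j C i j * D i j = \tr (C^T *m D).
  rewrite exchange_big; apply: eq_bigr => j _; rewrite mxE.
  by apply: eq_bigr => i _; rewrite mxE.
have -> : \sum_i \sum_k \sum_j err_quad x i k * (e i j * e k j) =
    \tr (e^T *m err_quad x *m e).
  rewrite -mulmxA -trE; apply: eq_bigr => i _; rewrite exchange_big.
  apply: eq_bigr => j _; rewrite mxE mulr_sumr; apply: eq_bigr => k _.
  by ring.
have sqfrobB (C D : 'M[R]_(n, q)) :
    sqfrob (C - D) = sqfrob D - 2 * (\sum_i \sum_j D i j * C i j) + sqfrob C.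
  rewrite /sqfrob mulr_sumr -sumrB -big_split; apply: eq_bigr => i _.
  rewrite mulr_sumr -sumrB -big_split; apply: eq_bigr => j _.
  by rewrite !mxE /=; ring.
rewrite sqfrobB /err_const; congr (_ + _ + _); last first.
  by rewrite sqfrob_tr /err_quad trmx_mul !mulmxA.
rewrite !trE /err_lin; set D := shrink x *m B.
rewrite !linearZ/= (trmx_mul _ D) trmxK -!scalemxAl !linearZ/= mulmxA.
by rewrite /GRing.scale/=; ring.
Qed.

Lemma expected_errorE x B (Sigma : 'M[R]_q) : (0 < n)%N ->
  n%:R^-1 * (err_const x B + \tr Sigma * \tr (err_quad x)) =
  ridge_bias (lam / n%:R) (gram x) B
  + ridge_variance n (lam / n%:R) (gram x) Sigma.
Proof.
move=> n0.
have nz : n%:R != 0 :> R by rewrite pnatr_eq0 -lt0n.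
have invE : invmx (gram x + (lam / n%:R)%:M) = n%:R *: ridge_inv x.
  have -> : gram x + (lam / n%:R)%:M = n%:R^-1 *: (x^T *m x + lam%:M).
    by rewrite scalerDr /gram scale_scalar_mx mulrC.
  have nu : n%:R^-1 \is a @GRing.unit R by rewrite unitrV unitfE.
  by rewrite invmxZ ?invrK// unitmxZ// reg_unit.
have biasE : err_const x B = lam ^+ 2 *
    \tr (B^T *m ridge_inv x *m (x^T *m x) *m ridge_inv x *m B).
  rewrite /err_const.
  have -> : sqfrob (lam *: (shrink x *m B)) = lam ^+ 2 * sqfrob (shrink x *m B).
    rewrite /sqfrob mulr_sumr; apply: eq_bigr => i _.
    by rewrite mulr_sumr; apply: eq_bigr => j _; rewrite mxE exprMn.
  rewrite sqfrob_tr /shrink !trmx_mul (trmx_resolvent _ (psd_trmx_mul x)).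
  by rewrite !mulmxA.
have varE : \tr (err_quad x) =
    \tr (x^T *m x *m ridge_inv x *m (x^T *m x) *m ridge_inv x).
  rewrite /err_quad tr_hat /hat /shrink !mulmxA mxtrace_mulC.
  by rewrite !mulmxA.
rewrite /ridge_bias /ridge_variance !invE biasE varE /gram.
rewrite !(=^~ scalemxAr, =^~ scalemxAl, scalerA, mxtraceZ).
by field.
Qed.

End RidgeAlgebra.

(** * Second moment of the normal law *)

Section GaussianSecondMoment.
Context {R : realType}.
Notation mu := (@lebesgue_measure R).
Import gauss_integral_proof.

Lemma is_derive_integral0_gauss (x : R) : 0 < x ->
  is_derive x 1 (@integral0_gauss R) (gauss_fun x).
Proof.
move=> x0.
have [dI I'] : derivable (@integral0_gauss R) x 1
    /\ (@integral0_gauss R)^`()%classic x = gauss_fun x.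
  apply: (@continuous_FTC1 R gauss_fun (BLeft 0) _ (x + 1)).
  - by rewrite ltrDl.
  - apply: continuous_compact_integrable => //; first exact: segment_compact.
    by apply: continuous_subspaceT; exact: continuous_gauss_fun.
  - by rewrite /= lte_fin.
  - by move=> ?; exact: continuous_gauss_fun.
by apply: DeriveDef; [exact: dI|rewrite -derive1E; exact: I'].
Qed.

(** The limit of the square is the Gauss integral; take square roots. *)
Lemma cvg_integral0_gauss :
  (@integral0_gauss R x) @[x --> +oo] --> Num.sqrt pi / 2.
Proof.
have : Num.sqrt (@integral0_gauss R x ^+ 2) @[x --> +oo] --> Num.sqrt (pi / 4).
  by apply: continuous_cvg;
    [exact: sqrt_continuous|exact: cvg_integral0_gauss_sqr].
have -> : (4 : R) = 2 ^+ 2 by rewrite expr2 -natrM.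
rewrite sqrtrM ?pi_ge0// sqrtrV// sqrtr_sqr ger0_norm//.
under eq_fun do rewrite sqrtr_sqr ger0_norm ?integral0_gauss_ge0//.
exact.
Qed.

Lemma mulr_gauss_fun_le_inv (x : R) : 0 < x -> x * gauss_fun x <= x^-1.
Proof.
move=> x0.
rewrite -(@ler_pM2l _ x)// mulfV ?gt_eqF// mulrA -expr2.
rewrite /gauss_fun expRN -ler_pdivlMr ?invr_gt0 ?expR_gt0// invrK mul1r.
by apply: le_trans (expR_ge1Dx _); rewrite lerDr.
Qed.

Lemma cvg_mulr_gauss_fun : (x * gauss_fun x : R) @[x --> +oo] --> (0 : R).
Proof.
apply: (@squeeze_cvgr _ _ _ _ (cst 0) (fun x : R => x^-1)).
- near=> x; rewrite mulr_gauss_fun_le_inv// andbT mulr_ge0 ?gauss_fun_ge0//.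
- exact: cvg_cst.
- rewrite gtr0_cvgV0; first exact: cvg_id.
  by near=> x; near: x; exact: nbhs_pinfty_gt.
Unshelve. all: end_near. Qed.

(** [x ^+ 2 * gauss_fun x] has the primitive [F]; using the primitive of the
    Gaussian itself inside [F] keeps the integrand nonnegative, so that the
    fundamental theorem applies on the whole half-line at once. *)
Lemma integral0y_sqr_gauss :
  (\int[mu]_(x in `[0%R, +oo[) (x ^+ 2 * gauss_fun x)%:E =
   (Num.sqrt pi / 4)%:E)%E.
Proof.
pose F := fun x : R => (@integral0_gauss R x - x * gauss_fun x) / 2.
have dg (x : R) : is_derive x 1 (@gauss_fun R) (- (2 * x) * gauss_fun x).
  rewrite /gauss_fun; apply: is_derive_eq.
  rewrite /GRing.scale/=; ring.
have dF (x : R) : 0 < x -> is_derive x 1 F (x ^+ 2 * gauss_fun x).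
  move=> x0; have ? := is_derive_integral0_gauss x0.
  rewrite /F; apply: is_derive_eq.
  by rewrite /GRing.scale/=; field.
have F0 : F 0 = 0.
  by rewrite /F mul0r subr0 /integral0_gauss set_itv1 Rintegral_set1 mul0r.
transitivity ((Num.sqrt pi / 4)%:E - (F 0)%:E)%E; last by rewrite F0 sube0.
apply: ge0_continuous_FTC2y.
- by move=> x _; rewrite mulr_ge0 ?sqr_ge0 ?gauss_fun_ge0.
- apply: continuous_subspaceT => x; apply: cvgM; first exact: exprn_continuous.
  exact: continuous_gauss_fun.
- have -> : Num.sqrt pi / 4 = (Num.sqrt pi / 2 - 0) / 2 :> R by field.
  apply: cvgMl; apply: cvgB; first exact: cvg_integral0_gauss.
  exact: cvg_mulr_gauss_fun.
- by move=> x /dF[].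
- apply: cvg_at_right_filter; apply: cvgMl; apply: cvgB.
    rewrite [X in _ --> X]/integral0_gauss set_itv1 Rintegral_set1.
    apply: (@parameterized_integral_cvg_left R 0 1) => //.
    apply: continuous_compact_integrable => //; first exact: segment_compact.
    by apply: continuous_subspaceT; exact: continuous_gauss_fun.
  apply: cvgM; first exact: cvg_id.
  exact: continuous_gauss_fun.
- by move=> x; rewrite in_itv/= andbT => /dF[_ <-]; rewrite derive1E.
Qed.
End GaussianSecondMoment.

Section NormalSecondMoment.
Context {R : realType}.
Notation mu := (@lebesgue_measure R).

Lemma integralT_sqr_gauss :
  (\int[mu]_x (x ^+ 2 * gauss_fun x)%:E = (Num.sqrt pi / 2)%:E)%E.
Proof.
rewrite ge0_symfun_integralT//=.
- rewrite -set_itvcy integral0y_sqr_gauss -EFinM; congr EFin; by field.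
- by move=> x; rewrite mulr_ge0 ?sqr_ge0 ?gauss_fun_ge0.
- move=> x; apply: cvgM; first exact: exprn_continuous.
  exact: continuous_gauss_fun.
- by move=> x/=; rewrite /gauss_fun !sqrrN.
Qed.

(** Substitute [x = c u] with [c = sqrt (2 s^2)]. *)
Lemma integral_sqr_normal_pdf (s : R) : s != 0 ->
  (\int[mu]_x (x ^+ 2 * normal_pdf 0 s x)%:E = (s ^+ 2)%:E)%E.
Proof.
move=> s0.
pose c := Num.sqrt (s ^+ 2 *+ 2).
have c0 : 0 < c by rewrite sqrtr_gt0 pmulrn_lgt0// exprn_even_gt0.
have c2 : c ^+ 2 = s ^+ 2 *+ 2 by rewrite sqr_sqrtr// mulrn_wge0// sqr_ge0.
pose F := fun x : R => x / c.
have dF (x : R) : is_derive x 1 F c^-1.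
  rewrite /F; apply: is_derive_eq; rewrite /GRing.scale/=.
  by field; rewrite gt_eqF.
have F'E : F^`()%classic = cst c^-1.
  by apply/funext => x; rewrite derive1E; case: (dF x).
pose G := fun x : R => x ^+ 2 * gauss_fun x.
have cG : continuous G.
  move=> x; apply: cvgM; first exact: exprn_continuous.
  exact: continuous_gauss_fun.
have G0 x : 0 <= G x by rewrite mulr_ge0 ?sqr_ge0 ?gauss_fun_ge0.
have subst : (\int[mu]_x (G x)%:E =
    \int[mu]_x (((G \o F) * F^`()%classic) x)%:E)%E.
  apply: increasing_ge0_integration_by_substitutionT => //.
  - by move=> x y xy; rewrite ltr_pM2r ?invr_gt0.
  - by rewrite F'E => ?; exact: cvg_cst.
  - by rewrite F'E; exact: is_cvg_cst.
  - by rewrite F'E; exact: is_cvg_cst.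
  - by apply/gt0_cvgMlNy; [rewrite invr_gt0|exact: cvg_id].
  - by apply/gt0_cvgMly; [rewrite invr_gt0|exact: cvg_id].
have peakE : normal_peak s = (c * Num.sqrt pi)^-1.
  rewrite /normal_peak -mulrnAl sqrtrM// mulrn_wge0// sqr_ge0//.
have sp0 : Num.sqrt pi != 0 :> R by rewrite gt_eqF// sqrtr_gt0 pi_gt0.
transitivity ((c ^+ 2 / Num.sqrt pi)%:E * \int[mu]_x (G x)%:E)%E; last first.
  rewrite integralT_sqr_gauss -EFinM c2; congr EFin.
  by field.
rewrite subst -ge0_integralZl//=.
- apply: eq_integral => x _; rewrite -EFinM; congr EFin.
  rewrite normal_pdfE// peakE F'E/= /normal_fun subr0 -c2.
  rewrite /= /G /gauss_fun /F fctE/=.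
  have -> : - (x / c) ^+ 2 = - x ^+ 2 / c ^+ 2.
    by field; rewrite gt_eqF.
  by field; rewrite gt_eqF.
- apply/measurable_EFinP; rewrite F'E; apply: measurable_funM => //.
  apply: measurableT_comp; first exact: continuous_measurable_fun.
  by apply: measurable_funM.
- by move=> x _; rewrite lee_fin F'E mulr_ge0//= ?G0// invr_ge0 ltW.
- by rewrite lee_fin divr_ge0 ?sqr_ge0 ?sqrtr_ge0.
Qed.

(** The normal density agrees almost everywhere with the Radon-Nikodym
    derivative, since both integrate to the same measure. *)
Lemma ge0_integral_normal_prob (m s : R) (f : R -> \bar R) :
  measurable_fun setT f -> (forall x, 0 <= f x)%E ->
  (\int[normal_prob m s]_x f x = \int[mu]_x (f x * (normal_pdf m s x)%:E))%E.
Proof.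
move=> mf f0.
have dom := normal_prob_dominates m s.
rewrite -(Radon_Nikodym_SigmaFinite.change_of_variables dom)//=.
have iRN := Radon_Nikodym_SigmaFinite.f_integrable dom.
apply: ae_eq_integral => //.
- by apply: emeasurable_funM => //; exact: (measurable_int mu).
- apply: emeasurable_funM => //; apply/measurable_EFinP.
  exact: measurable_normal_pdf.
- apply: ae_eqe_mul2l => /=.
  apply: integral_ae_eq => //=.
  + by apply/measurable_EFinP; exact: measurable_normal_pdf.
  + by move=> E _ mE; rewrite -(Radon_Nikodym_SigmaFinite.f_integral dom).
Qed.

Lemma integral_sqr_normal_prob (s : R) : s != 0 ->
  (\int[normal_prob 0 s]_x (x ^+ 2)%:E = (s ^+ 2)%:E)%E.
Proof.
move=> s0; rewrite ge0_integral_normal_prob.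
- by under eq_integral do rewrite -EFinM; exact: integral_sqr_normal_pdf.
- by apply/measurable_EFinP; exact: measurable_funX.
- by move=> x; rewrite lee_fin sqr_ge0.
Qed.

End NormalSecondMoment.

(** * Means of products of independent variables *)

Section Means.
Context d (T : measurableType d) (R : realType) (P : probability T R).
Implicit Types (U V : T -> R).

(** Integrability and value travel together, so that the closure rules below
    can be chained without separate integrability goals. *)
Definition has_mean U (m : R) : Prop :=
  P.-integrable setT (EFin \o U) /\ (\int[P]_w (U w)%:E = m%:E)%E.

Lemma has_mean_measurable U m : has_mean U m -> measurable_fun setT U.
Proof. by case=> /integrableP[/measurable_EFinP]. Qed.

Lemma integrable_has_mean U : P.-integrable setT (EFin \o U) ->
  has_mean U (fine (\int[P]_w (U w)%:E)%E).
Proof. by move=> iU; split => //; rewrite fineK// integrable_fin_num. Qed.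

Lemma has_mean_cst c : has_mean (cst c) c.
Proof.
split; first exact: finite_measure_integrable_cst.
by rewrite -[RHS]mule1 -(probability_setT P) -(integral_cst P).
Qed.

Lemma has_mean_uniq U a b : has_mean U a -> has_mean U b -> a = b.
Proof. by move=> [_ Ea] [_]; rewrite Ea => -[]. Qed.

Lemma has_meanD U V a b : has_mean U a -> has_mean V b ->
  has_mean (fun w => U w + V w) (a + b).
Proof.
move=> [iU EU] [iV EV]; split.
  by apply: eq_integrable (integrableD measurableT iU iV) => // w _.
under eq_integral do rewrite EFinD.
by rewrite integralD// EU EV.
Qed.

Lemma has_meanZ U a c : has_mean U a -> has_mean (fun w => c * U w) (c * a).
Proof.
move=> [iU EU]; split.
  by apply: eq_integrable (integrableZl measurableT c iU) => // w _.
under eq_integral do rewrite EFinM.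
by rewrite integralZl// EU.
Qed.

Lemma has_mean_sum (I : Type) (s : seq I) (U : I -> T -> R) (a : I -> R) :
  (forall i, has_mean (U i) (a i)) ->
  has_mean (fun w => \sum_(i <- s) U i w) (\sum_(i <- s) a i).
Proof.
move=> Ua; elim: s => [|i s IH].
  by under eq_fun do rewrite big_nil; rewrite big_nil; exact: has_mean_cst.
under eq_fun do rewrite big_cons; rewrite big_cons.
exact: has_meanD.
Qed.

Lemma bounded_integrable U C : measurable_fun setT U ->
  (forall w, `|U w| <= C) -> P.-integrable setT (EFin \o U).
Proof.
move=> mU bU; have iC := finite_measure_integrable_cst P C measurableT.
apply: le_integrable iC => //; first exact/measurable_EFinP.
by move=> w _; rewrite /= lee_fin (le_trans (bU w))// ler_norm.
Qed.

(** Independence says that the joint law of [U] and [V] is the product of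
    their laws; integrate the product with Fubini. *)
Lemma independent_mean_mul U V a b : independent_rvs P U V ->
  has_mean U a -> has_mean V b -> has_mean (fun w => U w * V w) (a * b).
Proof.
move=> indep Ua Vb.
have mU := has_mean_measurable Ua; have mV := has_mean_measurable Vb.
have mUV : measurable_fun setT (fun w => (U w, V w)).
  exact: measurable_fun_pair.
pose U' : {mfun T >-> R} := HB.pack U (isMeasurableFun.Build _ _ _ _ U mU).
pose V' : {mfun T >-> R} := HB.pack V (isMeasurableFun.Build _ _ _ _ V mV).
pose W : {mfun T >-> (R * R)%type} :=
  HB.pack (fun w => (U w, V w)) (isMeasurableFun.Build _ _ _ _ _ mUV).
pose PU := distribution P U'; pose PV := distribution P V'.
have joint (A : set (R * R)) : measurable A ->
    (PU \x PV)%E A = distribution P W A.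
  by apply: product_measure_unique => A1 A2 mA1 mA2; exact: indep.
pose f (z : R * R) := (z.1 * z.2)%:E.
have mf : measurable_fun setT f.
  by apply/measurable_EFinP; apply: measurable_funM.
have [iU EU] := Ua; have [iV EV] := Vb.
have mid : measurable_fun setT (fun x : R => `|x%:E|)%E.
  by apply: measurableT_comp => //; exact/measurable_EFinP.
have PV_abs : (\int[PV]_y `|y%:E| < +oo)%E.
  rewrite (@ge0_integral_distribution _ _ _ _ _ P V')//.
  by case/integrableP: iV.
have PU_abs : (\int[PU]_y `|y%:E| < +oo)%E.
  rewrite (@ge0_integral_distribution _ _ _ _ _ P U')//.
  by case/integrableP: iU.
have PV_mean : (\int[PV]_y y%:E = b%:E)%E.
  by rewrite (@integral_distribution _ _ _ _ _ P V')//; exact/measurable_EFinP.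
have PU_mean : (\int[PU]_y y%:E = a%:E)%E.
  by rewrite (@integral_distribution _ _ _ _ _ P U')//; exact/measurable_EFinP.
have iidV : PV.-integrable setT (EFin : R -> \bar R).
  by apply/integrableP; split => //; exact/measurable_EFinP.
have iidU : PU.-integrable setT (EFin : R -> \bar R).
  by apply/integrableP; split => //; exact/measurable_EFinP.
have inner_abs x : (\int[PV]_y `|f (x, y)| = `|x%:E| * \int[PV]_y `|y%:E|)%E.
  rewrite -ge0_integralZl//; apply: eq_integral => y _.
  by rewrite -abseM.
have inner x : (\int[PV]_y f (x, y) = x%:E * b%:E)%E.
  rewrite -PV_mean -integralZl//; exact: eq_integral.
have iprod : (PU \x PV)%E.-integrable setT f.
  apply/integrable12ltyP => //.
  under eq_integral do rewrite inner_abs.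
  rewrite /= ge0_integralZr//; last exact: integral_ge0.
  rewrite lte_mul_pinfty//; first exact: integral_ge0.
  by rewrite ge0_fin_numE// integral_ge0.
have prodE : (\int[PU \x PV]_z f z = (a * b)%:E)%E.
  rewrite -integral12_prod_meas1//.
  rewrite (eq_integral (fun x : R => x%:E * b%:E)%E) => [|x _];
    last exact: inner.
  by rewrite integralZr// PU_mean EFinM.
(* Transport integrability back along the joint law. *)
have iW : P.-integrable setT (f \o W).
  apply/integrableP; split; first exact: measurableT_comp.
  have mabs : measurable_fun setT (abse \o f) by exact: measurableT_comp.
  rewrite -(@ge0_integral_distribution _ _ _ _ _ P W (abse \o f))//=.
  rewrite (eq_measure_integral (PU \x PV)%E); first by case/integrableP: iprod.
  by move=> A mA _; exact/esym/joint.
split; first exact: iW.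
transitivity (\int[distribution P W]_z f z)%E.
  by rewrite (@integral_distribution _ _ _ _ _ P W).
rewrite -prodE; apply: eq_measure_integral => A mA _.
exact/esym/joint.
Qed.

End Means.

(** * Measurable and bounded matrix functions *)

Section MeasurableMatrices.
Context {R : realType}.

Lemma measurable_mx_entry m n (i : 'I_m) (j : 'I_n) :
  measurable_fun setT (fun M : 'M[R]_(m, n) => M i j).
Proof.
move=> _ B mB; rewrite setTI; apply: sub_sigma_algebra.
by exists i, j, B.
Qed.

(** The inverse is written [y * (y ^+ 2) `^ (-1)] because real powers are
    measurable; at [y = 0] both sides vanish. *)
Lemma measurable_inv d (T : measurableType d) (f : T -> R) :
  measurable_fun setT f -> measurable_fun setT (fun x => (f x)^-1).
Proof.
move=> mf.
have -> : (fun x => (f x)^-1) = (fun x => f x * (f x ^+ 2) `^ (-1)).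
  apply/funext => x; rewrite powR_inv1 ?sqr_ge0//.
  have [->|f0] := eqVneq (f x) 0; first by rewrite invr0 mul0r.
  by rewrite expr2 invfM mulVKf.
apply: measurable_funM => //.
apply: (measurableT_comp (measurable_powR _)).
exact: measurable_funX.
Qed.

Context d (T : measurableType d).

Definition measurable_mx m n (F : T -> 'M[R]_(m, n)) : Prop :=
  forall i j, measurable_fun setT (fun x => F x i j).

Definition bounded_mx m n (F : T -> 'M[R]_(m, n)) : Prop :=
  exists C, forall x i j, `|F x i j| <= C.

Lemma measurable_mx_mul m n p (F : T -> 'M[R]_(m, n)) (G : T -> 'M[R]_(n, p)) :
  measurable_mx F -> measurable_mx G -> measurable_mx (fun x => F x *m G x).
Proof.
move=> mF mG i j; under eq_fun do rewrite mxE.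
by apply: measurable_sum => k; exact: measurable_funM.
Qed.

Lemma measurable_mx_tr m n (F : T -> 'M[R]_(m, n)) :
  measurable_mx F -> measurable_mx (fun x => (F x)^T).
Proof. by move=> mF i j; under eq_fun do rewrite mxE; exact: mF. Qed.

Lemma measurable_mx_cst m n (A : 'M[R]_(m, n)) : measurable_mx (fun=> A).
Proof. by move=> i j; exact: measurable_cst. Qed.

Lemma measurable_mxZ m n (F : T -> 'M[R]_(m, n)) c :
  measurable_mx F -> measurable_mx (fun x => c *: F x).
Proof.
move=> mF i j; under eq_fun do rewrite mxE.
by apply: measurable_funM => //; exact: mF.
Qed.

Lemma measurable_mxD m n (F G : T -> 'M[R]_(m, n)) :
  measurable_mx F -> measurable_mx G -> measurable_mx (fun x => F x + G x).
Proof.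
move=> mF mG i j; under eq_fun do rewrite mxE.
by apply: measurable_funD; [exact: mF|exact: mG].
Qed.

Lemma measurable_det m (F : T -> 'M[R]_m) :
  measurable_mx F -> measurable_fun setT (fun x => \det (F x)).
Proof.
move=> mF; apply: measurable_sum => s; apply: measurable_funM => //.
by apply: measurable_prod => i _; exact: mF.
Qed.

(** Cramer's rule: entries of the inverse are quotients of polynomials in the
    entries. *)
Lemma measurable_mx_inv m (F : T -> 'M[R]_m) :
  (forall x, F x \in unitmx) ->
  measurable_mx F -> measurable_mx (fun x => invmx (F x)).
Proof.
move=> uF mF i j.
have -> : (fun x => invmx (F x) i j) =
    (fun x => (\det (F x))^-1 * cofactor (F x) j i).
  by apply/funext => x; rewrite /invmx uF !mxE.
apply: measurable_funM; first exact/measurable_inv/measurable_det.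
apply: measurable_funM => //; apply: measurable_det => k l.
by under eq_fun do rewrite !mxE; exact: mF.
Qed.

Lemma bounded_mx_mul m n p (F : T -> 'M[R]_(m, n)) (G : T -> 'M[R]_(n, p)) :
  bounded_mx F -> bounded_mx G -> bounded_mx (fun x => F x *m G x).
Proof.
move=> [C FC] [D GD]; exists (\sum_(k < n) C * D) => x i j; rewrite mxE.
apply: le_trans (ler_norm_sum _ _ _) _; apply: ler_sum => k _.
by rewrite normrM ler_pM.
Qed.

Lemma bounded_mx_tr m n (F : T -> 'M[R]_(m, n)) :
  bounded_mx F -> bounded_mx (fun x => (F x)^T).
Proof. by move=> [C FC]; exists C => x i j; rewrite mxE. Qed.

Lemma bounded_mx_cst m n (A : 'M[R]_(m, n)) : bounded_mx (fun=> A).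
Proof.
exists (\sum_i \sum_j `|A i j|) => _ i j.
rewrite (bigD1 i)//= (bigD1 j)//= -addrA lerDl addr_ge0//.
  exact: sumr_ge0.
by apply: sumr_ge0 => k _; exact: sumr_ge0.
Qed.

Lemma bounded_mxZ m n (F : T -> 'M[R]_(m, n)) c :
  bounded_mx F -> bounded_mx (fun x => c *: F x).
Proof.
by move=> [C FC]; exists (`|c| * C) => x i j; rewrite mxE normrM ler_wpM2l.
Qed.

Lemma measurable_sqfrob m n (F : T -> 'M[R]_(m, n)) :
  measurable_mx F -> measurable_fun setT (fun x => sqfrob (F x)).
Proof.
move=> mF; apply: measurable_sum => i; apply: measurable_sum => j.
by apply: measurable_funX; exact: mF.
Qed.

Lemma bounded_sqfrob m n (F : T -> 'M[R]_(m, n)) :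
  bounded_mx F -> exists C, forall x, `|sqfrob (F x)| <= C.
Proof.
move=> [C FC]; exists (\sum_(i < m) \sum_(j < n) C ^+ 2) => x.
rewrite ger0_norm ?sqfrob_ge0//; apply: ler_sum => i _; apply: ler_sum => j _.
rewrite -[leLHS]ger0_norm ?sqr_ge0// normrX lerXn2r ?nnegrE//.
exact: le_trans (FC x i j).
Qed.

End MeasurableMatrices.

Section RidgeCoefficients.
Context {R : realType} (n p q : nat) (lam : R) (B : 'M[R]_(p, q)).
Hypothesis lam_gt0 : 0 < lam.

Lemma measurable_shrink :
  measurable_mx (fun x : 'M[R]_(n, p) => shrink lam x).
Proof.
have mid : measurable_mx (fun x : 'M[R]_(n, p) => x).
  by move=> i j; exact: measurable_mx_entry.
apply: measurable_mx_mul => //; apply: measurable_mx_inv.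
  by move=> x; exact: shift_unitmx (psd_trmx_mul x) lam_gt0.
apply: measurable_mxD; last exact: measurable_mx_cst.
by apply: measurable_mx_mul => //; exact: measurable_mx_tr.
Qed.

Lemma measurable_hat : measurable_mx (fun x : 'M[R]_(n, p) => hat lam x).
Proof.
apply: measurable_mx_mul; first exact: measurable_shrink.
by apply: measurable_mx_tr => i j; exact: measurable_mx_entry.
Qed.

Lemma bounded_shrink : bounded_mx (fun x : 'M[R]_(n, p) => shrink lam x).
Proof.
exists (lam^-1 + 1) => x i j.
have : `|shrink lam x i j| ^+ 2 <= lam^-1.
  rewrite -normrX ger0_norm ?sqr_ge0// -[leRHS]mulr1 ler_pdivlMl//.
  exact: shrink_entry_le1.
have : 0 < lam^-1 by rewrite invr_gt0.
by have := normr_ge0 (shrink lam x i j); nra.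
Qed.

Lemma bounded_hat : bounded_mx (fun x : 'M[R]_(n, p) => hat lam x).
Proof. by exists 1 => x i k; exact: hat_entry_le1. Qed.

Lemma measurable_err_const :
  measurable_fun setT (fun x : 'M[R]_(n, p) => err_const lam x B).
Proof.
apply: measurable_sqfrob; apply: measurable_mxZ.
apply: measurable_mx_mul; first exact: measurable_shrink.
exact: measurable_mx_cst.
Qed.

Lemma bounded_err_const :
  exists C, forall x : 'M[R]_(n, p), `|err_const lam x B| <= C.
Proof.
apply: bounded_sqfrob; apply: bounded_mxZ.
by apply: bounded_mx_mul; [exact: bounded_shrink|exact: bounded_mx_cst].
Qed.

Lemma measurable_err_lin :
  measurable_mx (fun x : 'M[R]_(n, p) => err_lin lam x B).
Proof.
apply: measurable_mxZ; apply: measurable_mx_mul.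
  by apply: measurable_mx_tr; exact: measurable_hat.
apply: measurable_mx_mul; first exact: measurable_shrink.
exact: measurable_mx_cst.
Qed.

Lemma bounded_err_lin : bounded_mx (fun x : 'M[R]_(n, p) => err_lin lam x B).
Proof.
apply: bounded_mxZ; apply: bounded_mx_mul.
  by apply: bounded_mx_tr; exact: bounded_hat.
by apply: bounded_mx_mul; [exact: bounded_shrink|exact: bounded_mx_cst].
Qed.

Lemma measurable_err_quad :
  measurable_mx (fun x : 'M[R]_(n, p) => err_quad lam x).
Proof.
apply: measurable_mx_mul; last exact: measurable_hat.
by apply: measurable_mx_tr; exact: measurable_hat.
Qed.

Lemma bounded_err_quad : bounded_mx (fun x : 'M[R]_(n, p) => err_quad lam x).
Proof.
apply: bounded_mx_mul; last exact: bounded_hat.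
by apply: bounded_mx_tr; exact: bounded_hat.
Qed.

End RidgeCoefficients.

(** * Moments of the noise *)

Section GaussianNoise.
Context d (T : measurableType d) (R : realType) (P : probability T R).

Lemma normal_law_sqr_mean (Z : T -> R) v : measurable_fun setT Z -> 0 <= v ->
  normal_law P Z 0 v -> has_mean P (fun w => Z w ^+ 2) v.
Proof.
move=> mZ v0 lawZ.
(* The target carries the display of the Lebesgue measure, which is the one
   of [normal_prob]. *)
pose Z' : {mfun T >-> measurableTypeR R} :=
  HB.pack (Z : T -> measurableTypeR R)
    (isMeasurableFun.Build _ _ T (measurableTypeR R) Z mZ).
have msq : measurable_fun setT (fun x : measurableTypeR R => (x ^+ 2)%:E).
  by apply/measurable_EFinP; exact: measurable_funX.
have EZ2 : (\int[P]_w (Z w ^+ 2)%:E = v%:E)%E.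
  transitivity (\int[distribution P Z']_x (x ^+ 2)%:E)%E.
    rewrite (@ge0_integral_distribution _ _ _ _ _ P Z')// => x.
    by rewrite lee_fin sqr_ge0.
  have [ve|vn] := eqVneq v 0.
    (* Zero variance: the law is the point mass at [0]. *)
    rewrite (eq_measure_integral (\d_(0 : measurableTypeR R))); last first.
      by move=> A mA _; have := lawZ A mA; rewrite ve eqxx.
    by rewrite integral_dirac// diracT mul1e expr0n ve.
  have s0 : Num.sqrt v != 0 by rewrite sqrtr_eq0 -ltNge lt_neqAle eq_sym vn.
  rewrite (eq_measure_integral (normal_prob 0 (Num.sqrt v))); last first.
    by move=> A mA _; have := lawZ A mA; rewrite (negbTE vn).
  by rewrite integral_sqr_normal_prob// sqr_sqrtr.
split => //; apply/integrableP; split.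
  by apply/measurable_EFinP; exact: measurable_funX.
under eq_integral do rewrite /= ger0_norm ?sqr_ge0//.
by rewrite EZ2 ltry.
Qed.

Lemma sqr_integrable (Z : T -> R) v : measurable_fun setT Z ->
  has_mean P (fun w => Z w ^+ 2) v -> P.-integrable setT (EFin \o Z).
Proof.
move=> mZ [iZ2 _].
have i1 := finite_measure_integrable_cst P (1 : R) measurableT.
have := integrableD measurableT i1 iZ2.
apply: le_integrable => //; first exact/measurable_EFinP.
move=> w _; rewrite /= lee_fin [leRHS]ger0_norm ?addr_ge0 ?sqr_ge0//.
rewrite -[X in _ <= _ + X]real_normK ?num_real//.
by have := normr_ge0 (Z w); nra.
Qed.

(** [Z] and [- Z] have the same law, so the mean equals its opposite. *)
Lemma symmetric_normal_mean0 (Z : T -> R) v : measurable_fun setT Z ->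
  0 <= v -> normal_law P Z 0 v -> normal_law P (fun w => - Z w) 0 v ->
  has_mean P Z 0.
Proof.
move=> mZ v0 lawZ lawNZ.
have iZ := sqr_integrable mZ (normal_law_sqr_mean mZ v0 lawZ).
have Zm := integrable_has_mean iZ; set m := fine _ in Zm.
have NZm := has_meanZ (-1) Zm.
have mNZ : measurable_fun setT (fun w => - Z w) by exact: measurable_funN.
pose Z' : {mfun T >-> R} := HB.pack Z (isMeasurableFun.Build _ _ _ _ Z mZ).
pose NZ' : {mfun T >-> R} :=
  HB.pack (fun w => - Z w) (isMeasurableFun.Build _ _ _ _ _ mNZ).
have mid : measurable_fun setT (EFin : R -> \bar R) by exact/measurable_EFinP.
have : (\int[distribution P Z']_x x%:E = \int[distribution P NZ']_x x%:E)%E.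
  apply: eq_measure_integral => A mA _.
  exact: etrans (lawZ A mA) (esym (lawNZ A mA)).
rewrite (@integral_distribution _ _ _ _ _ P Z')//.
rewrite (@integral_distribution _ _ _ _ _ P NZ')//; last first.
  by case: NZm => + _; apply: eq_integrable => // w _; rewrite /= mulN1r.
case: (Zm) => _ ->.
have -> : (\int[P]_x (EFin \o NZ') x = (-1 * m)%:E)%E.
  by rewrite -(proj2 NZm); apply: eq_integral => w _; rewrite mulN1r.
move=> [] mE; have m0 : m = 0 by move: mE; lra.
by move: Zm; rewrite m0.
Qed.

Context (n q : nat) (E : {RV P >-> 'M[R]_(n, q)}) (Sigma : 'M[R]_q).
Hypotheses (Sigma_psd : psd_mx Sigma)
  (indep_rows : mutually_independent P (fun (i : 'I_n) w => row i (E w)))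
  (normal_rows : forall i : 'I_n,
     mvnormal_law P (fun w => row i (E w)) 0 Sigma).

Lemma measurable_noise_entry i j : measurable_fun setT (fun w => E w i j).
Proof.
by apply: (measurableT_comp (measurable_mx_entry i j)) => //.
Qed.

Let axis (a : R) (j : 'I_q) : 'cV[R]_q := a *: delta_mx j 0.

Let entryE i j a w : (row i (E w) *m axis a j) 0 0 = a * E w i j.
Proof. by rewrite /axis -scalemxAr -colE !mxE. Qed.

Let varE j a : ((axis a j)^T *m Sigma *m axis a j) 0 0 = a ^+ 2 * Sigma j j.
Proof.
have -> : (axis a j)^T = a *: delta_mx 0 j by rewrite linearZ/= trmx_delta.
rewrite /axis -scalemxAr -!scalemxAl scalerA -rowE -colE.
by rewrite !mxE expr2.
Qed.

Let entry_law i j a :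
  normal_law P (fun w => a * E w i j) 0 (a ^+ 2 * Sigma j j).
Proof.
have -> : (fun w => a * E w i j) = (fun w => (row i (E w) *m axis a j) 0 0).
  by apply/funext => w; rewrite entryE.
have -> : 0 = ((0 : 'rV[R]_q) *m axis a j) 0 0 by rewrite mul0mx mxE.
by rewrite -varE; exact: normal_rows.
Qed.

Let Sigma_diag_ge0 j : 0 <= Sigma j j.
Proof. by have := proj2 Sigma_psd (axis 1 j); rewrite varE expr1n mul1r. Qed.

Lemma noise_mean i j : has_mean P (fun w => E w i j) 0.
Proof.
apply: (@symmetric_normal_mean0 _ (Sigma j j)) => //.
- exact: measurable_noise_entry.
- have := entry_law i j 1; rewrite expr1n mul1r.
  by under eq_fun do rewrite mul1r.
- have := entry_law i j (-1); rewrite sqrrN expr1n mul1r.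
  by under eq_fun do rewrite mulN1r.
Qed.

(** Take the product rule over all rows, with the whole space as event for
    every row other than [i] and [k]. *)
Lemma noise_rows_independent i k j : i != k ->
  independent_rvs P (fun w => E w i j) (fun w => E w k j).
Proof.
move=> ik A B mA mB.
pose C (l : 'I_n) : set 'rV[R]_q :=
  if l == i then [set M : 'rV[R]_q | A (M 0 j)] else
  if l == k then [set M : 'rV[R]_q | B (M 0 j)] else [set: 'rV[R]_q].
have mC l : measurable (C l).
  have entry D : measurable D -> measurable [set M : 'rV[R]_q | D (M 0 j)].
    by move=> mD; rewrite -[X in measurable X]setTI; exact: measurable_mx_entry.
  by rewrite /C; case: ifP => _; [exact: entry|case: ifP => _; [exact: entry|]].
have := indep_rows mC.
have -> : \bigcap_(l in [set: 'I_n]) ((fun w => row l (E w)) @^-1` C l) =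
    (fun w => E w i j) @^-1` A `&` (fun w => E w k j) @^-1` B.
  apply/seteqP; split=> [w EC|w [/= Aw Bw] l _].
    have := EC i I; have := EC k I.
    by rewrite /C /= !eqxx eq_sym (negbTE ik) /= !mxE.
  rewrite /C /=; case: eqP => [->|_]; first by rewrite /= mxE.
  by case: eqP => [->|_]; rewrite //= mxE.
move=> ->; rewrite (bigD1 i)//= (bigD1 k) 1?eq_sym//= big1 => [|l /andP[li lk]].
  rewrite mule1; congr (P _ * P _)%E.
    by rewrite /C eqxx; apply/seteqP; split => w /=; rewrite mxE.
  rewrite /C eq_sym (negbTE ik) eqxx.
  by apply/seteqP; split => w /=; rewrite mxE.
by rewrite /C (negbTE li) (negbTE lk) preimage_setT probability_setT.
Qed.

Lemma noise_product_mean i k j :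
  has_mean P (fun w => E w i j * E w k j) (if i == k then Sigma j j else 0).
Proof.
have [<-|ik] := eqVneq i k.
  under eq_fun do rewrite -expr2.
  apply: normal_law_sqr_mean => //; first exact: measurable_noise_entry.
  have := entry_law i j 1; rewrite expr1n mul1r.
  by under eq_fun do rewrite mul1r.
rewrite -[X in has_mean _ _ X](mul0r 0).
apply: independent_mean_mul; [|exact: noise_mean..].
exact: noise_rows_independent.
Qed.

End GaussianNoise.

(** * Expected prediction error *)

Section ExpectedError.
Context d (T : measurableType d) (R : realType) (P : probability T R).

Lemma independent_rvs_comp d1 (T1 : measurableType d1)
    d2 (T2 : measurableType d2)
    d3 (T3 : measurableType d3) d4 (T4 : measurableType d4)
    (U : T -> T1) (V : T -> T2) (f : T1 -> T3) (g : T2 -> T4) :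
  measurable_fun setT f -> measurable_fun setT g ->
  independent_rvs P U V ->
  independent_rvs P (fun w => f (U w)) (fun w => g (V w)).
Proof.
move=> mf mg indep A B mA mB.
apply: (indep (f @^-1` A) (g @^-1` B)).
  by rewrite -[X in measurable X]setTI; exact: mf.
by rewrite -[X in measurable X]setTI; exact: mg.
Qed.

Lemma independent_rvs_cst d1 (T1 : measurableType d1)
    d2 (T2 : measurableType d2)
    (x : T1) (V : T -> T2) :
  independent_rvs P (fun=> x) V.
Proof.
move=> A B mA mB; have [xA|xA] := pselect (A x).
  have -> : (fun=> x : T1) @^-1` A = [set: T] by apply/seteqP; split.
  by rewrite setTI probability_setT mul1e.
have -> : (fun=> x : T1) @^-1` A = set0 :> set T by apply/seteqP; split.
by rewrite set0I measure0 mul0e.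
Qed.

Context (n p q : nat) (lam : R) (B : 'M[R]_(p, q)).
Context (E : {RV P >-> 'M[R]_(n, q)}) (Sigma : 'M[R]_q).
Hypotheses (lam_gt0 : 0 < lam) (Sigma_psd : psd_mx Sigma)
  (indep_rows : mutually_independent P (fun (i : 'I_n) w => row i (E w)))
  (normal_rows : forall i : 'I_n,
     mvnormal_law P (fun w => row i (E w)) 0 Sigma).

(** The prediction error at design [x], averaged over the noise. *)
Definition mean_error (x : 'M[R]_(n, p)) : R :=
  err_const lam x B + \tr Sigma * \tr (err_quad lam x).

Lemma measurable_mean_error : measurable_fun setT mean_error.
Proof.
apply: measurable_funD; first exact: measurable_err_const.
apply: measurable_funM => //; apply: measurable_sum => i.
exact: (measurable_err_quad lam_gt0).
Qed.

(** The defining property of conditional expectation, with a bounded weight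
    [phi (X w)] in place of the indicator of an event.  The weight [1] gives
    the integrability of both sides, and, for constant [X], the risk at a
    fixed design.  In the expansion of the error each summand is a bounded
    function of [X] times a function of [E], and its mean factors. *)
Lemma weighted_error_mean (X : T -> 'M[R]_(n, p)) (phi : 'M[R]_(n, p) -> R) :
  measurable_fun setT X -> independent_rvs P X E ->
  measurable_fun setT phi -> (forall x, `|phi x| <= 1) ->
  exists m,
    has_mean P (fun w => phi (X w) * mean_error (X w)) m /\
    has_mean P
      (fun w => phi (X w) * sq_pred_error lam (X w) (X w *m B + E w) B) m.
Proof.
move=> mX indep mphi phi1.
pose wmean (c : 'M[R]_(n, p) -> R) :=
  fine (\int[P]_w (phi (X w) * c (X w))%:E)%E.
have wmeanP (c : 'M[R]_(n, p) -> R) : measurable_fun setT c ->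
    (exists C, forall x, `|c x| <= C) ->
    has_mean P (fun w => phi (X w) * c (X w)) (wmean c).
  move=> mc [C cC]; apply: integrable_has_mean.
  apply: (@bounded_integrable _ _ _ _ _ C) => [|w].
    apply: (@measurableT_comp _ _ _ _ _ _ (fun x => phi x * c x)) => //.
    exact: measurable_funM.
  by rewrite normrM -[C]mul1r ler_pM.
have const_mean := wmeanP _ (measurable_err_const B lam_gt0)
  (bounded_err_const _ B lam_gt0).
have lin_mean i j : has_mean P
    (fun w => phi (X w) * err_lin lam (X w) B i j * E w i j) 0.
  have [C linC] := bounded_err_lin n B lam_gt0.
  have bm : has_mean P (fun w => phi (X w) * err_lin lam (X w) B i j)
      (wmean (fun x => err_lin lam x B i j)).
    by apply: wmeanP; [exact: (measurable_err_lin _ lam_gt0)|exists C].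
  rewrite -(mulr0 (wmean (fun x => err_lin lam x B i j))).
  apply: independent_mean_mul bm _; last first.
    exact: (noise_mean Sigma_psd normal_rows).
  have mf : measurable_fun setT (fun x => phi x * err_lin lam x B i j).
    by apply: measurable_funM => //; exact: (measurable_err_lin _ lam_gt0).
  exact: (independent_rvs_comp mf (measurable_mx_entry i j) indep).
pose quad i k := wmean (fun x => err_quad lam x i k).
have quad_mean i k :
    has_mean P (fun w => phi (X w) * err_quad lam (X w) i k) (quad i k).
  have [C quadC] := bounded_err_quad n p lam_gt0.
  by apply: wmeanP; [exact: (measurable_err_quad lam_gt0)|exists C].
have quad_noise_mean i k j : has_mean P
    (fun w => phi (X w) * err_quad lam (X w) i k * (E w i j * E w k j))
    (quad i k * (if i == k then Sigma j j else 0)).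
  apply: independent_mean_mul (quad_mean i k) _; last first.
    exact: (noise_product_mean Sigma_psd indep_rows normal_rows).
  have mf : measurable_fun setT (fun x => phi x * err_quad lam x i k).
    by apply: measurable_funM => //; exact: (measurable_err_quad lam_gt0).
  have mg : measurable_fun setT (fun e : 'M[R]_(n, q) => e i j * e k j).
    by apply: measurable_funM; exact: measurable_mx_entry.
  exact: (independent_rvs_comp mf mg indep).
exists (wmean (fun x => err_const lam x B) + \tr Sigma * \sum_i quad i i).
split.
  have := has_meanD const_mean
    (has_meanZ (\tr Sigma)
      (has_mean_sum (index_enum 'I_n) (fun i => quad_mean i i))).
  congr has_mean; apply/funext => w; rewrite /mean_error -mulr_sumr.
  by rewrite -/(\tr (err_quad lam (X w))); ring.
have := has_meanD (has_meanD const_mean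
  (has_mean_sum (index_enum 'I_n) (fun i =>
    has_mean_sum (index_enum 'I_q) (lin_mean i))))
  (has_mean_sum (index_enum 'I_n) (fun i =>
    has_mean_sum (index_enum 'I_n) (fun k =>
      has_mean_sum (index_enum 'I_q) (quad_noise_mean i k)))).
congr has_mean; first apply/funext => w.
  rewrite sq_pred_errorE// !mulrDr; congr (_ + _ + _).
    rewrite mulr_sumr; apply: eq_bigr => i _.
    by rewrite mulr_sumr; apply: eq_bigr => j _; rewrite -mulrA.
  rewrite mulr_sumr; apply: eq_bigr => i _.
  rewrite mulr_sumr; apply: eq_bigr => k _.
  by rewrite mulr_sumr; apply: eq_bigr => j _; rewrite -mulrA.
rewrite (big1 _ _ (fun i => \sum_(j : 'I_q) 0)) ?addr0 => [|i _];
  last exact: big1.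
congr (_ + _); rewrite mulr_sumr; apply: eq_bigr => i _.
rewrite (bigD1 i)//= [X in _ + X]big1 ?addr0 => [|k ki].
  by under eq_bigr do rewrite eqxx; rewrite -mulr_sumr mulrC.
by rewrite big1// => j _; rewrite eq_sym (negbTE ki) mulr0.
Qed.

End ExpectedError.

(** * Prediction risk of the ridge estimator *)

Theorem lemma3p1 (R : realType) (d : measure_display) (T : measurableType d)
    (P : probability T R) (n p q : nat)
    (X : {RV P >-> 'M[R]_(n, p)}) (E : {RV P >-> 'M[R]_(n, q)})
    (Y : T -> 'M[R]_(n, q)) (B : 'M[R]_(p, q)) (Sigma : 'M[R]_q) (lam : R)
    (n_gt0 : (0 < n)%N) (p_gt0 : (0 < p)%N)
    (Sigma_psd : psd_mx Sigma)
    (model : forall w, Y w = X w *m B + E w)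
    (indep_XE : independent_rvs P X E)
    (indep_rows : mutually_independent P (fun (i : 'I_n) w => row i (E w)))
    (normal_rows : forall i : 'I_n,
       mvnormal_law P (fun w => row i (E w)) 0 Sigma)
    (lam_gt0 : 0 < lam) :
  let lamt := lam / n%:R in
  [/\ cond_pred_risk P lam X Y B
        (fun w => ridge_bias lamt (gram (X w)) B
                  + ridge_variance n lamt (gram (X w)) Sigma),
      (forall x : 'M[R]_(n, p),
         fixed_design_pred_risk P lam x E B =
         (ridge_bias lamt (gram x) B
          + ridge_variance n lamt (gram x) Sigma)%:E),
      (forall x : 'M[R]_(n, p),
         ridge_bias lamt (gram x) B <=
         lamt ^+ 2 * lambda_max (gram x) / (lambda_min (gram x) + lamt) ^+ 2
         * frobenius_norm B ^+ 2) &
      (forall x : 'M[R]_(n, p),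
         ridge_variance n lamt (gram x) Sigma <=
         p%:R * \tr Sigma / n%:R
         * (lambda_max (gram x) ^+ 2 / (lambda_min (gram x) + lamt) ^+ 2))].
Proof.
move=> lamt.
have lamt0 : 0 < lamt by rewrite divr_gt0// ltr0n.
have weighted := weighted_error_mean B lam_gt0 Sigma_psd indep_rows
  normal_rows.
have mX : measurable_fun setT X by [].
have one_le1 (x : 'M[R]_(n, p)) : `|cst (1 : R) x| <= 1 by rewrite normr1.
split.
- have -> : Y = (fun w => X w *m B + E w) by apply/funext.
  exists (fun w => mean_error lam B Sigma (X w)); last first.
    by move=> w; rewrite -expected_errorE.
  have [m [[imean _] [ierr _]]] :=
    weighted X (cst 1) mX indep_XE (measurable_cst _) one_le1.
  split.
  + by apply: eq_integrable ierr => // w _; rewrite /= mul1r.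
  + by apply: eq_integrable imean => // w _; rewrite /= mul1r.
  + move=> C mC; exists (mean_error lam B Sigma @^-1` C); last by rewrite setTI.
    rewrite -[X in measurable X]setTI.
    exact: (measurable_mean_error B Sigma lam_gt0).
  + move=> _ [C mC <-].
    have ind_le1 (x : 'M[R]_(n, p)) : `|\1_C x : R| <= 1.
      by rewrite indicE; case: (_ \in _); rewrite ?normr1 ?normr0.
    have [c [[_ Emean] [_ Eerr]]] :=
      weighted X \1_C mX indep_XE (measurable_indic mC) ind_le1.
    have restrict (f : T -> R) :
        (\int[P]_(w in setT `&` X @^-1` C) (f w)%:E =
         \int[P]_w (\1_C (X w) * f w)%:E)%E.
      rewrite setTI integral_mkcond; apply: eq_integral => w _.
      rewrite patchE indicE.
      have -> : (w \in X @^-1` C) = (X w \in C).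
        by apply/idP/idP => /set_mem/mem_set.
      by case: (X w \in C); rewrite ?mul1r ?mul0r.
    by rewrite !restrict Emean Eerr.
- move=> x; rewrite /fixed_design_pred_risk unlock.
  have indep_x : independent_rvs P (fun=> x) E by exact: independent_rvs_cst.
  have [m [meanx [_ Eerr]]] :=
    weighted _ (cst 1) (measurable_cst x) indep_x (measurable_cst _) one_le1.
  have mE : mean_error lam B Sigma x = m.
    have cm := has_mean_cst P (1 * mean_error lam B Sigma x).
    by rewrite -[LHS]mul1r; refine (has_mean_uniq cm meanx).
  under eq_integral do rewrite -[sq_pred_error _ _ _ _]mul1r.
  by rewrite Eerr -mE -EFinM -expected_errorE.
- by move=> x; apply: ridge_bias_le => //; exact: psd_gram.
- by move=> x; apply: ridge_variance_le => //; exact: psd_gram.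
Qed.
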